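(* Let $(X,r)$ be a finite non-degenerate square-free $\mathrm{SD}$ braided set, $r(x,y)=(\sigma_x(y),x)$ for all $x,y\in X$. Suppose that $|X|>1$ and that the number of $r$-orbits in $X^2$ is $2|X|-1$. Then, up to isomorphism, one of the following holds: (1) $|X|$ is an odd prime and $(X,r)$ is the braided set associated to the dihedral quandle (of order $|X|$); (2) $|X|=2$ and $(X,r)$ is the trivial braided set; (3) $X=\{1,2,3\}$ and $\sigma_1=\sigma_2=\mathrm{id}$, $\sigma_3=(1,2)$.
   Context: A quadratic set $(X,r)$ is a nonempty set $X$ with a bijective map $r\colon X\times X\to X\times X$, written $r(x,y)=(\sigma_x(y),\gamma_y(x))$. It is non-degenerate if all $\sigma_x$ and $\gamma_x$ are bijective, square-free if $r(x,x)=(x,x)$ for all $x\in X$, and $\mathrm{SD}$ if all $\gamma_y=\mathrm{id}$, i.e. $r(x,y)=(\sigma_x(y),x)$. It is a braided set if $r_1r_2r_1=r_2r_1r_2$ on $X^3$, where $r_1=r\times \mathrm{id}_X$ and $r_2=\mathrm{id}_X\times r$. The $r$-orbits in $X^2$ are the orbits of the group $\langle r\rangle$ acting on $X^2$. An isomorphism $(X,r)\to(Y,s)$ is a bijection $f\colon X\to Y$ with $(f\times f)\circ r=s\circ(f\times f)$. The braided set associated to the dihedral quandle of order $n$ is $(\mathbb{Z}/(n),r)$ with $r(i,j)=(2i-j,i)$. The trivial braided set on $X$ is given by $r(x,y)=(y,x)$ for all $x,y\in X$. *)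

(* Defs.v *)
From mathcomp Require Import all_boot all_order all_algebra all_fingroup.
Set Implicit Arguments.
Unset Strict Implicit.
Unset Printing Implicit Defensive.
Import GRing.Theory.

(* A finite quadratic set (X, r) is a finType X with r : {perm X * X}; the
   number of r-orbits in X^2 is #|porbits r|, since porbit r z is by definition
   the orbit of z under the cyclic group <[r]>. *)
Section QuadraticSets.
Variable X : finType.
Implicit Type r : {perm X * X}.

Definition sigma r (x y : X) : X := (r (x, y)).1.
Definition gamma r (y x : X) : X := (r (x, y)).2.

Definition non_degenerate r : Prop :=
  forall x, bijective (sigma r x) /\ bijective (gamma r x).

Definition square_free r : Prop := forall x, r (x, x) = (x, x).

Definition SD r : Prop := forall y, gamma r y =1 id.

Definition r_12 r (t : X * X * X) : X * X * X := (r t.1, t.2).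
Definition r_23 r (t : X * X * X) : X * X * X :=
  let u := r (t.1.2, t.2) in (t.1.1, u.1, u.2).

Definition braided r : Prop :=
  r_12 r \o r_23 r \o r_12 r =1 r_23 r \o r_12 r \o r_23 r.

Definition is_trivial r : Prop := forall x y, r (x, y) = (y, x).

Definition sd_fun (s : X -> {perm X}) (z : X * X) : X * X := (s z.1 z.2, z.1).

Lemma sd_fun_inj (s : X -> {perm X}) : injective (sd_fun s).
Proof. by case=> [x y] [x' y'] [eq_s eq_x]; move: eq_s; rewrite /= eq_x => /perm_inj->. Qed.

Definition sd_perm (s : X -> {perm X}) : {perm X * X} := perm (@sd_fun_inj s).

End QuadraticSets.

Definition isomorphic (X Y : finType) (r : {perm X * X}) (s : {perm Y * Y}) :
  Prop :=
  exists f : X -> Y, bijective f /\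
    forall x y, let u := r (x, y) in (f u.1, f u.2) = s (f x, f y).

Lemma dihedral_inj n (i : 'Z_n) : injective (fun j : 'Z_n => (i *+ 2 - j)%R).
Proof. by move=> j k /addrI /oppr_inj. Qed.

(* 'Z_n is Z/(n) only for n > 1. *)
Definition dihedral n : {perm 'Z_n * 'Z_n} :=
  sd_perm (fun i : 'Z_n => perm (@dihedral_inj n i)).

(* The points 1, 2, 3 are the ordinals 0, 1, 2 of 'I_3. *)
Definition three_point : {perm 'I_3 * 'I_3} :=
  sd_perm (fun i : 'I_3 =>
    if i == inord 2 then tperm (inord 0) (inord 1) else 1%g).

(* Main.v *)
Require Import Defs.
From mathcomp Require Import all_boot all_order all_algebra all_fingroup cyclic.
Set Implicit Arguments.
Unset Strict Implicit.
Unset Printing Implicit Defensive.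

(**
The maps [s x] make [X] a quandle, and [r (x, y) = (s x y, x)] preserves both
the product [s x \o s y] and the relation [s x = s y]. Call the classes of this
relation fibres.

On a pair [(a, b)] inside a fibre [r] is the flip, so a fibre of size [m] carries
[m (m + 1) / 2 >= 2 m - 1] orbits, with equality only for [m <= 2]. For a fixed
[x] the products [s x \o s y], with [y] outside the fibre of [x], separate
as many orbits of pairs lying in different fibres as there are other fibres.
Altogether there are at least [2 |X| - 1] orbits, and if this bound is attained
([orbit_normal_form]), then
 - fibres have at most two elements ([fibre_le2]);
 - an orbit joining different fibres contains, for every [x], a pair with first
   component [x] ([orbit_meets_row]); hence two points of different fibres
   generate [X] ([generate]);
 - an orbit joining different fibres is determined by its first component and
   the fibre of its second one ([porbit_right]).

Suppose that there are at least three fibres. On the level of fibres, [s x]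
fixes only the fibre of [x], the product of [s x] and [s z] fixes no fibre when
[x] and [z] lie in different fibres, and [x |-> s x e] is injective. Given [y]
and [w], solve [s z (s y w) = w] in [z]: unless [z] lies in the fibre of [y],
a product of two distinct translations fixes [w]. So [s y] is an involution on
fibres ([sq_central]), then on points ([s_invol]). The translations are
thus reflections inverting the rotation [t = s a \o s b]; this forces the fibres
to be singletons ([s_inj]) and [k |-> point k], with [s (point k)] the
composite of [s b] and [t ^+ k], to be an isomorphism from the dihedral quandle of
order [#[t] = |X|]. As any two points generate, every non-trivial power of [t]
generates [<[t]>], so that [|X|] is prime.

With exactly two fibres the translations preserve every fibre, and the pairs
[(a, y)] with [y] in the other fibre lie in a single orbit. This makes a fibre of
size 2 be swapped by the translations of the other fibre ([swaps_fibre]) and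
excludes two fibres of size 2 ([singleton_fibre]), which leaves the three-point
quandle. A single fibre has at most two points. Finally, on a set of size 2 each
[s x] fixes [x], hence is the identity.
*)

(** * Orbits of the quandle structure *)

Section Quandle.
Local Open Scope group_scope.
Variables (X : finType) (r : {perm X * X}) (s : X -> {perm X}).
Hypothesis rE : forall x y, r (x, y) = (s x y, x).
Hypothesis sxx : forall x, s x x = x.
Hypothesis sJ : forall x y, s (s x y) = s y ^ s x.

Lemma sJ_self x : s x ^ s x = s x.
Proof. by rewrite -sJ sxx. Qed.

Lemma porbit_ind (P : X * X -> Prop) z w :
  (forall x y, P (x, y) -> P (s x y, x)) -> P z -> w \in porbit r z -> P w.
Proof.
move=> Pr Pz /porbitP[i ->]; elim: i => [|i]; first by rewrite expg0 perm1.
by rewrite expgSr permM; case: ((r ^+ i) z) => x y /Pr; rewrite rE.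
Qed.

(** The invariant that separates orbits: [s x \o s y] is the image of the word
    [x y] in the group of translations. Products of permutations compose from
    left to right, hence the order of the factors. *)
Lemma porbit_prod a b c d :
  (c, d) \in porbit r (a, b) -> s d * s c = s b * s a.
Proof.
apply: (porbit_ind (P := fun z => s z.2 * s z.1 = s b * s a)) => //= x y <-.
by rewrite sJ conjgE !mulgA mulgV mul1g.
Qed.

Lemma porbit_fibre a b c d : s a = s b ->
  (c, d) \in porbit r (a, b) -> (c, d) = (a, b) \/ (c, d) = (b, a).
Proof.
move=> eq_s; apply: (porbit_ind (P := fun z => z = (a, b) \/ z = (b, a))).
  by move=> x y [[-> ->]|[-> ->]]; [right; rewrite eq_s sxx|left; rewrite -eq_s sxx].
by left.
Qed.

Lemma porbit_same_fibre a b c d :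
  (c, d) \in porbit r (a, b) -> (s c = s d) <-> (s a = s b).
Proof.
suff H a' b' c' d' : (c', d') \in porbit r (a', b') -> s a' = s b' -> s c' = s d'.
  by move=> cd; split; apply: H; rewrite // porbit_sym.
by move=> cd eq_s; case: (porbit_fibre eq_s cd) => -[-> ->].
Qed.

Lemma r_sq a b : r (r (a, b)) = ((s b * s a) a, (s b * s a) b).
Proof. by rewrite !rE sJ conjgE !permM (canLR (permK _) (esym (sxx a))) sxx. Qed.

(** The square of [r] acts on the orbit of [(a, b)] as one fixed inner
    automorphism, because the product is constant along the orbit. *)
Lemma r_even a b m :
  (r ^+ m.*2) (a, b) = (((s b * s a) ^+ m) a, ((s b * s a) ^+ m) b).
Proof.
elim: m => [|m IHm]; first by rewrite !expg0 !perm1.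
rewrite doubleS !expgSr !(permM _ r) IHm r_sq.
have /porbit_prod-> : (((s b * s a) ^+ m) a, ((s b * s a) ^+ m) b) \in porbit r (a, b).
  by rewrite -IHm mem_porbit.
by rewrite !(permM _ (s b * s a)).
Qed.

Lemma s_expg a b m x :
  s (((s b * s a) ^+ m) x) = s x ^ ((s b * s a) ^+ m).
Proof.
elim: m => [|m IHm]; first by rewrite expg0 perm1 conjg1.
by rewrite expgSr !permM !sJ IHm !conjgM.
Qed.

(** With at most two fibres the induced quandle structure on the set of fibres
    is trivial. *)
Lemma s_const a b :
  (forall x, s x = s a \/ s x = s b) -> forall x y, s (s x y) = s y.
Proof.
move=> two_fibres x y.
have two u v : s u <> s v -> s (s u v) = s v.
  move=> uv; suff : s (s u v) <> s u.
    by case: (two_fibres u) (two_fibres v) (two_fibres (s u v)) uv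
      => -> [] -> [] -> // /(_ erefl).
  by rewrite sJ -[X in _ <> X]sJ_self => /conjg_inj/esym.
have [xy|/eqP xy] := eqVneq (s x) (s y); last exact: two.
by rewrite sJ xy sJ_self.
Qed.

(** * Counting orbits *)

Section Counting.
Hypothesis (horb : #|porbits r| = (2 * #|X| - 1)%N).

(** Let [rho] choose a point in each fibre. The orbits of the pairs [(y, y)], of
    [(y, rho y)] for [y != rho y], and of [(x, y)] for [y = rho y != rho x] are
    pairwise distinct, and there are [|X| + (|X| - 1)] of them, so they are all
    the orbits. *)
Lemma orbit_normal_form (rho : X -> X) (x : X) :
    (forall y, s (rho y) = s y) -> (forall y z, s y = s z -> rho y = rho z) ->
  forall a b, [\/ a = b,
    exists2 y, y != rho y & (y, rho y) \in porbit r (a, b) |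
    exists2 y, rho y = y & (x, y) \in porbit r (a, b)].
Proof.
move=> s_rho rho_eq a b.
pose basic (u : X + {y | y != rho x}) : {set X * X} :=
  match u with
  | inl y => porbit r (y, y)
  | inr y => if rho (val y) == val y then porbit r (x, val y)
             else porbit r (val y, rho (val y))
  end.
have eq_mem z w : porbit r z = porbit r w -> w \in porbit r z.
  by move=> ->; apply: porbit_id.
have diag y c d : porbit r (y, y) = porbit r (c, d) -> (c, d) = (y, y).
  by move=> /eq_mem/(porbit_fibre (erefl (s y)))[].
have mixed y z : y != rho x -> rho y = y ->
    porbit r (x, y) = porbit r (z, rho z) -> False.
  move=> y_x yK /eq_mem /porbit_same_fibre[H _].
  by case/eqP: y_x; rewrite -yK; apply: rho_eq; rewrite H ?s_rho.
(* The first two kinds lie inside a fibre, where r is the flip; those of the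
   third kind are told apart by the product of translations. *)
have basic_inj : injective basic.
  move=> [y|[y y_x]] [z|[z z_x]] //=.
  - by case/diag=> ->.
  - case: eqP => zK /diag[]; last by move=> <- /zK.
    by move=> xy zy; case/eqP: z_x; rewrite -zK zy xy.
  - case: eqP => yK /esym/diag[]; last by move=> <- /yK.
    by move=> xz yz; case/eqP: y_x; rewrite -yK xz yz.
  case: eqP => [yK|_]; case: eqP => [zK|/eqP nz].
  - move/eq_mem/porbit_prod/mulIg=> eq_s; congr inr; apply: val_inj => /=.
    by rewrite -yK -zK (rho_eq _ _ eq_s).
  - by move/mixed=> [].
  - by move/esym/mixed=> [].
  move/eq_mem/(porbit_fibre (esym (s_rho y)))=> [[zy _]|[zy yz]].
    by congr inr; apply: val_inj.
  by case/eqP: nz; rewrite [RHS]zy; apply: rho_eq; rewrite zy s_rho.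
have all_basic : [set basic u | u : X + {y | y != rho x}] = porbits r.
  apply/eqP; rewrite eqEcard; apply/andP; split.
    apply/subsetP=> _ /imsetP[[y|[y y_x]] _ ->] /=; first exact: imset_f.
    by case: ifP => _; apply: imset_f.
  have -> : #|[set basic u | u : X + {y | y != rho x}]| = #|{: X + {y | y != rho x}}|.
    by rewrite card_imset.
  rewrite card_sum card_sig horb.
  have X_gt0 : (0 < #|X|)%N by apply/card_gt0P; exists x.
  by rewrite cardC1 -subn1 addnBA // addnn -mul2n.
have: porbit r (a, b) \in porbits r by apply: imset_f.
rewrite -all_basic => /imsetP[[y|[y y_x]] _ /=].
  by case/esym/diag=> -> ->; constructor 1.
by case: eqP => [yK|/eqP ny] /eq_mem ab; [constructor 3|constructor 2];
  exists y; rewrite 1?eq_sym.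
Qed.

(** A choice of a point in each fibre that selects [c] in its own fibre. *)
Definition rep (c y : X) : X :=
  if s y == s c then c else odflt y [pick z | s z == s y].

Lemma s_rep c y : s (rep c y) = s y.
Proof.
rewrite /rep; case: eqP => [->//|_].
by case: pickP => [z /eqP|].
Qed.

Lemma rep_eq c y z : s y = s z -> rep c y = rep c z.
Proof.
rewrite /rep => ->; case: eqP => // _.
by case: pickP => [//|/(_ z)]; rewrite eqxx.
Qed.

Lemma repK c y : s y = s c -> rep c y = c.
Proof. by rewrite /rep => ->; rewrite eqxx. Qed.

(** Choosing [c] as the representative of its fibre, the orbit of [(a, b)] must
    be one of the orbits [{(y, c), (c, y)}] or [{(y, y)}]. *)
Lemma fibre_le2 a b c : s a = s b -> s b = s c -> [\/ a = b, a = c | b = c].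
Proof.
move=> ab bc.
case: (orbit_normal_form a (s_rep c) (@rep_eq c) a b) => [->|[y _]|[y yK]].
- by constructor 1.
- case/(porbit_fibre ab) => -[ya yb]; [constructor 3|constructor 2].
    by rewrite -yb repK // ya ab.
  by rewrite -yb repK // ya.
case/(porbit_fibre ab) => [[yb]|[_ yb]]; [constructor 3|constructor 2].
  by rewrite -yb -yK repK // yb.
by rewrite -yb -yK repK // yb ab.
Qed.

Lemma orbit_meets_row a b x : s a <> s b -> exists y, (x, y) \in porbit r (a, b).
Proof.
move=> ab; case: (orbit_normal_form x (s_rep x) (@rep_eq x) a b).
- by move=> eq_ab; case: ab; rewrite eq_ab.
- by case=> y _ /porbit_same_fibre[H _]; case: ab; rewrite -H // s_rep.
by case=> y _ xy; exists y.
Qed.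

(** Both orbits contain a pair [(a, y)] with [y] a representative, and the
    product of translations determines which representative. *)
Lemma porbit_right a b c :
  s a <> s b -> s b = s c -> (a, c) \in porbit r (a, b).
Proof.
have aux d : s a <> s d -> exists2 y, rep a y = y & (a, y) \in porbit r (a, d).
  move=> ad; case: (orbit_normal_form a (s_rep a) (@rep_eq a) a d) => //.
    by move=> eq_ad; case: ad; rewrite eq_ad.
  by case=> y _ /porbit_same_fibre[H _]; case: ad; rewrite -H // s_rep.
move=> ab bc; have [y yK ay] := aux b ab.
have [|z zK az] := aux c; first by rewrite -bc.
suff yz : y = z.
  by move: ay az; rewrite -!eq_porbit_mem yz => /eqP-> /eqP->.
rewrite -yK -zK; apply: rep_eq; apply: (mulIg (s a)).
by rewrite (porbit_prod ay) (porbit_prod az) bc.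
Qed.

Lemma generate (A : X -> Prop) a b :
    (forall x y, A x -> A y -> A (s x y)) -> A a -> A b -> s a <> s b ->
  forall x, A x.
Proof.
move=> AM Aa Ab ab x; have [y xy] := orbit_meets_row x ab.
suff [] : A (x, y).1 /\ A (x, y).2 by [].
apply: (porbit_ind (P := fun z => A z.1 /\ A z.2)) xy => //=.
by move=> u v [Au Av]; split=> //; apply: AM.
Qed.

(** * At least three fibres *)

Section ManyFibres.
Hypothesis fibres_gt2 : (2 < #|s @: [set: X]|)%N.

Lemma avoid_two_fibres a b : exists2 c, s c <> s a & s c <> s b.
Proof.
have: ~~ (s @: [set: X] \subset [set s a; s b]).
  apply: contraL fibres_gt2 => /subset_leq_card; rewrite cards2 -leqNgt => /leq_trans; apply.
  by case: (_ != _).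
case/subsetPn=> _ /imsetP[c _ ->]; rewrite !inE => /norP[/eqP ca /eqP cb].
by exists c.
Qed.

(** If [s x] fixes the fibre of [y], then [s x] and [s y] commute, and the
    fibres of [x] and [y] together form a proper subquandle. If these fibres were
    distinct, [x] and [y] would generate [X]. *)
Lemma fixed_fibre x y : s (s x y) = s y -> s x = s y.
Proof.
move=> fix_y; apply/eqP/negPn/negP=> /eqP xy.
have cxy : commute (s x) (s y).
  by apply/commute_sym/commgP/conjg_fixP; rewrite -sJ.
have [c cx cy] := avoid_two_fibres x y.
suff [] : s c = s x \/ s c = s y by [].
apply: (generate (A := fun e => s e = s x \/ s e = s y) _ _ _ xy c); auto.
move=> u v su sv.
suff -> : s (s u v) = s v by [].
rewrite sJ; apply/conjg_fixP/commgP.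
by case: su sv => -> [] ->; do ?[exact: commute_refl | exact: commute_sym].
Qed.

(** Moving along the orbit of [(x, z)] to a pair [(e, w)], the product becomes
    [s e \o s w]; it fixes the fibre of [e] only if [s w] does. *)
Lemma prod_no_fixed_fibre x z e : s (s x (s z e)) = s e -> s x = s z.
Proof.
move=> fix_e; apply/eqP/negPn/negP=> /eqP xz.
have [w ew] := orbit_meets_row e xz.
apply: xz; apply/(porbit_same_fibre ew)/esym/fixed_fibre/(conjg_inj (s e)).
by rewrite sJ_self sJ -conjgM (porbit_prod ew) conjgM -!sJ fix_e.
Qed.

(** If [s x] and [s y] agree on the fibre of [e], write
    [s x \o s e = s y \o s w]: then [s w] fixes the fibre of [e], so [w] lies in
    it and cancelling gives [s x = s y]. *)
Lemma s_latin x y e : s (s x e) = s (s y e) -> s x = s y.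
Proof.
move=> eq_e; have [ex|/eqP xe] := eqVneq (s x) (s e).
  by rewrite ex; apply/esym/fixed_fibre; rewrite -eq_e sJ ex sJ_self.
have [w yw] := orbit_meets_row y xe.
have sw : s w = s e * s x * (s y)^-1 by rewrite -(porbit_prod yw) mulgK.
have we : s w = s e.
  apply: fixed_fibre.
  by rewrite sJ sw !conjgM sJ_self -sJ eq_e sJ conjgK.
by apply: (mulgI (s e)); rewrite -(porbit_prod yw) we.
Qed.

(** By [s_latin] and finiteness, some [z] has [s z (s y x)] in the fibre of [x];
    then [s z \o s y] fixes this fibre, so [s z = s y]. *)
Lemma sq_central x y : s x ^ (s y * s y) = s x.
Proof.
pose v := s (s y x).
have inj_v : {in s @: [set: X] &, injective (fun t => v ^ t)}.
  by move=> _ _ /imsetP[z _ ->] /imsetP[w _ ->]; rewrite -!sJ => /s_latin.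
have: s x \in (fun t => v ^ t) @: (s @: [set: X]).
  suff -> : (fun t => v ^ t) @: (s @: [set: X]) = s @: [set: X] by apply: imset_f.
  apply/eqP; rewrite eqEcard (card_in_imset inj_v) leqnn andbT.
  by apply/subsetP=> _ /imsetP[_ /imsetP[z _ ->] ->]; rewrite -sJ imset_f.
case/imsetP=> _ /imsetP[z _ ->]; rewrite -sJ => /esym zx.
have zy := prod_no_fixed_fibre zx.
by move: zx; rewrite zy !sJ -conjgM.
Qed.

(** The fixed points of an automorphism commuting with the translations form a
    subquandle stable under all of them, so they meet several fibres as soon as
    there is one. *)
Lemma central_fixing_eq1 h y :
  (forall x, commute h (s x)) -> h y = y -> h = 1.
Proof.
move=> hC hy; have [z _ zy] := avoid_two_fibres y y.
apply/permP=> x; rewrite perm1.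
have hs u v : h (s u v) = s u (h v) by rewrite -!permM (hC u).
apply: (generate (A := fun e => h e = e) (a := y) (b := s z y)) => //.
- by move=> u v _ hv; rewrite hs hv.
- by rewrite hs hy.
by move=> /esym/fixed_fibre.
Qed.

Lemma s_invol y : s y * s y = 1.
Proof.
apply: (central_fixing_eq1 (y := y)); last by rewrite permM !sxx.
by move=> x; apply/commute_sym/commgP/conjg_fixP/sq_central.
Qed.

Lemma s_invV x : (s x)^-1 = s x.
Proof. by apply/eqP; rewrite eq_invg_mul s_invol. Qed.

(** Two distinct points [b] and [b'] of a fibre would give
    [(a, b') = r^k (a, b)] for some [k]. For [k] even, the corresponding power
    of [g] centralises every [s x] and fixes [a], so it is the identity. For
    [k] odd, number the second components along the orbit, [b] having index 0
    and [b'] index [k]. The reflection [s b] reverses indices and fixes [b'], so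
    [g ^+ k] fixes [b'], and then [b] too, which is in the same [<[g]>]-orbit;
    but [g ^+ k] sends [b] to [b']. Here [g] is [s b * s a]. *)
Lemma s_inj : injective s.
Proof.
move=> b b' bb'; have [a ab _] := avoid_two_fibres b b.
have /porbitP[k] := porbit_right ab bb'.
have refl m : s b * (s b * s a) ^+ m * s b = (s b * s a) ^- m.
  rewrite -expgVn invMg !s_invV -{1}[s b]s_invV -mulgA -conjgE conjXg.
  by rewrite conjgE !mulgA mulVg mul1g.
rewrite -(odd_double_half k); case: (odd k); last first.
  rewrite add0n r_even; set m := k./2; set h := _ ^+ m => -[ha hb].
  suff h1 : h = 1 by rewrite hb h1 perm1.
  apply: (central_fixing_eq1 (y := a)) => // x.
  apply/commute_sym/commgP/conjg_fixP.
  apply: (generate (A := fun e => s e ^ h = s e) _ _ _ ab) => [u v hu hv||].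
  - by rewrite sJ conjJg hu hv.
  - by rewrite -s_expg -/h -ha.
  by rewrite -s_expg -/h -hb bb'.
rewrite add1n expgSr permM r_even; set m := k./2; set g := s b * s a; set h := _ ^+ m.
rewrite rE s_expg permJ -/h => -[a_hb b'_ha].
have a_ghb : (g * h) b = a by rewrite !permM sxx.
have gh : g * h = h * g by rewrite -expgS -expgSr.
(* The reflection: a and b' = h a are the points of index k + 1 and k. *)
have hhg_a : (h * h * g) a = a.
  have b'_fix : s b b' = b' by rewrite bb' sxx.
  have : (h^-1) (s b a) = b'.
    by rewrite -refl !permM -(permM (s b) (s b) a) s_invol perm1 -/h -b'_ha.
  move/(canRL (permKV _)) => sba.
  by rewrite !permM -b'_ha -sba -(permM (s b) (s b)) s_invol perm1 sxx.
have : (g * h) ((g * h * h) b) = (g * h) b.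
  have swap : g * h * h * (g * h) = g * h * (h * h * g) by rewrite -(mulgA h h) -gh !mulgA.
  by rewrite -permM swap permM a_ghb.
by move/perm_inj; rewrite permM a_ghb -b'_ha => ->.
Qed.

(** * The dihedral case *)

Section Dihedral.
Variables a b : X.
Hypothesis ab : s a <> s b.
Variable t : {perm X}.
Hypothesis tE : t = s b * s a.

Lemma flip u : u \in <[t]> -> u * s b = s b * u^-1.
Proof.
case/cycleP=> i ->; rewrite conjgC conjXg -expgVn; congr (_ * _ ^+ _).
by rewrite tE conjgE invMg !s_invV !mulgA s_invol mul1g.
Qed.

Lemma subgroup_closed (H : {group {perm X}}) x y :
  s b * s x \in H -> s b * s y \in H -> s b * s (s x y) \in H.
Proof.
move=> xH yH; have -> : s b * s (s x y) = (s b * s x) * (s b * s y)^-1 * (s b * s x).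
  by rewrite sJ invMg conjgE !s_invV !mulgA -(mulgA _ (s b) (s b)) s_invol mulg1.
by apply: groupM => //; apply: groupM; rewrite ?groupV.
Qed.

(** The second component of [r^k (a, b)], so that [point 0 = b] and
    [point 1 = a]. *)
Definition point k : X := (t ^+ (k./2)) (if odd k then a else b).

Lemma s_point k : s (point k) = s b * t ^+ k.
Proof.
have flipK i : t ^- i * s b = s b * t ^+ i.
  by rewrite flip ?invgK // groupV mem_cycle.
rewrite /point tE s_expg -tE conjgE -[in RHS](odd_double_half k) addnC -addnn -addnA expgD.
case: odd; last by rewrite addn0 !mulgA flipK.
have -> : s a = s b * t by rewrite tE mulgA s_invol mul1g.
by rewrite !mulgA flipK -!mulgA -expgS addn1.
Qed.

(** Any [u != 1] in [<[t]>] is [s b * s c] for some [c], and [b] and [c]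
    generate [X], in particular [a]; so [<[u]>] contains [s b * s a = t]. *)
Lemma cycle_generate u : u \in <[t]> -> u != 1 -> t \in <[u]>.
Proof.
case/cycleP=> i uE u1; have sc : s (point i) = s b * u by rewrite uE s_point.
pose A x := s b * s x \in <[u]>.
rewrite tE; apply: (generate (A := A) (a := point i) (b := b) _ _ _ _ a).
- by move=> ? ?; apply: subgroup_closed.
- by rewrite /A sc mulgA s_invol mul1g cycle_id.
- by rewrite /A s_invol group1.
by rewrite sc => /(canRL (mulKg _)); rewrite mulVg; apply/eqP.
Qed.

Lemma t_neq1 : t != 1.
Proof. by rewrite tE; apply/eqP=> /(canRL (mulKg _)); rewrite mulg1 s_invV => /ab. Qed.

Lemma point_inj i j : (point i == point j) = (i == j %[mod #[t]]).
Proof. by rewrite -(inj_eq s_inj) !s_point (inj_eq (mulgI _)) eq_expg_mod_order. Qed.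

Lemma in_cycle x : s b * s x \in <[t]>.
Proof.
apply: (generate (A := fun x => s b * s x \in <[t]>) _ _ _ ab).
- by move=> ? ?; apply: subgroup_closed.
- by rewrite -tE cycle_id.
by rewrite s_invol group1.
Qed.

Lemma order_t : #[t] = #|X|.
Proof.
apply/eqP; rewrite eqn_leq; apply/andP; split.
  have inj : injective (fun i : 'I_#[t] => point i).
    by move=> i j /eqP; rewrite point_inj !modn_small // => /eqP/val_inj.
  by rewrite -[X in (X <= _)%N]card_ord; apply: leq_card inj.
have inj : injective (fun x => s b * s x) by move=> x y /mulgI/s_inj.
rewrite -(card_imset _ inj); apply: subset_leq_card; apply/subsetP.
by move=> _ /imsetP[x _ ->]; apply: in_cycle.
Qed.

Lemma prime_card : prime #|X|.
Proof.
rewrite -order_t; have t_gt1 : (1 < #[t])%N by rewrite order_gt1 t_neq1.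
have := pdiv_prime t_gt1; set p := pdiv _ => p_pr.
suff -> : #[t] = p by [].
apply/eqP; rewrite eqn_leq (pdiv_leq (ltnW t_gt1)) andbT leqNgt; apply/negP=> p_lt.
have tp1 : t ^+ p != 1.
  by rewrite -order_dvdn gtnNdvd // prime_gt0.
have := cycle_generate (mem_cycle _ _) tp1.
rewrite -cycle_subG => /subset_leq_card; rewrite -!orderE leqNgt orderXdiv ?pdiv_dvd //.
by rewrite ltn_Pdiv ?prime_gt1 // ltnW.
Qed.

Lemma dihedral_point (i j : 'Z_#|X|) :
  point (i *+ 2 - j)%R = s (point i) (point j).
Proof.
have X_gt1 : (1 < #|X|)%N by rewrite prime_gt1 // prime_card.
have tD (k l : 'Z_#|X|) : t ^+ (k + l)%R = t ^+ k * t ^+ l.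
  by rewrite -expgD /= [X in _ %% X]Zp_cast // expg_mod // -order_t expg_order.
apply: s_inj; rewrite sJ !s_point.
have -> : t ^+ (i *+ 2 - j)%R = t ^- j * t ^+ i * t ^+ i.
  apply: (mulgI (t ^+ j)); rewrite -tD GRing.addrC GRing.subrK GRing.mulr2n tD.
  by rewrite -!mulgA mulKVg.
have -> : t ^- j * t ^+ i = (t ^- i * t ^+ j)^-1 by rewrite invMg invgK.
rewrite mulgA -flip; last by rewrite groupM ?groupV ?mem_cycle.
by rewrite conjgE invMg s_invV !mulgA -(mulgA _ (s b) (s b)) s_invol mulg1.
Qed.

Lemma iso_dihedral : isomorphic r (dihedral #|X|).
Proof.
have X_gt1 : (1 < #|X|)%N by rewrite prime_gt1 // prime_card.
have inj : injective (fun i : 'Z_#|X| => point i).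
  move=> i j /eqP; rewrite point_inj order_t => /eqP.
  by rewrite !modn_small -?[X in (_ < X)%N](Zp_cast X_gt1) // => /val_inj.
have [|f pointK fK] := inj_card_bij inj; first by rewrite card_ord Zp_cast.
exists f; split; first by exists (fun i : 'Z_#|X| => point i).
move=> x y; rewrite rE /= permE /sd_fun /= permE; congr pair.
by apply: (canLR pointK); rewrite dihedral_point !fK.
Qed.

End Dihedral.
End ManyFibres.

(** * Two fibres *)

(** If [s a] fixed [b], every pair in the orbit of [(a, b)] would involve [b],
    and this orbit also contains [(a, c)]. *)
Lemma swaps_fibre a b c :
  (forall x y, s (s x y) = s y) -> s a <> s b -> s b = s c -> b <> c -> s a b = c.
Proof.
move=> sM ab bc b_c.
have [||//] : [\/ s a b = b, s a b = c | b = c]; last by [].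
  by apply: fibre_le2; rewrite ?sM.
move=> fix_b; case: b_c.
have := porbit_right ab bc.
pose P z := (s z.1 = s a /\ z.2 = b) \/ (z.1 = b /\ s z.2 = s a).
suff H z : z \in porbit r (a, b) -> P z.
  by case/H=> /= -[]; [move=> _ ->|move=> _ ca; case: ab; rewrite -ca bc].
apply: (porbit_ind (P := P)); last by left.
rewrite /P => u v /= [[ua ->]|[-> va]]; first by right; rewrite ua fix_b.
by left; rewrite sM.
Qed.

(** Two fibres [{a, x}] and [{b, c}] of size 2 are swapped by each other's
    translations; then the orbit of [(a, b)] has the four elements listed in the
    proof, and misses [(a, c)]. *)
Lemma singleton_fibre a b c x :
  (forall x y, s (s x y) = s y) -> s a <> s b -> s b = s c -> b <> c -> s x = s a ->
  x = a.
Proof.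
move=> sM ab bc b_c xa; apply/eqP/negPn/negP=> /eqP x_a.
have ab' : s a <> s c by rewrite -bc.
have sab : s a b = c by apply: swaps_fibre.
have sac : s a c = b by apply: swaps_fibre; auto.
have sba : s b a = x by apply: swaps_fibre; auto.
have sbx : s b x = a by apply: swaps_fibre; rewrite ?xa; auto.
have := porbit_right ab bc.
pose P z := [\/ z = (a, b), z = (c, a), z = (x, c) | z = (b, x)].
suff H z : z \in porbit r (a, b) -> P z.
  by case/H=> -[]; auto; move=> e; case: ab; rewrite ?e ?bc // -bc -e.
apply: (porbit_ind (P := P)); last by constructor 1.
move=> u v [[-> ->]|[-> ->]|[-> ->]|[-> ->]]; rewrite /P ?xa -?bc.
- by constructor 2; rewrite sab.
- by constructor 3; rewrite sba.
- by constructor 4; rewrite sac.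
by constructor 1; rewrite sbx.
Qed.

Lemma iso_three_point a b c :
  s a <> s b -> (forall x, s x = s a \/ s x = s b) -> s b = s c -> b <> c ->
  isomorphic r three_point.
Proof.
move=> ab two bc b_c; have sM := s_const two.
have bound x : [\/ x = a, x = b | x = c].
  case: (two x) => [xa|xb]; first by constructor 1; exact: (singleton_fibre sM ab bc b_c xa).
  by case: (fibre_le2 xb bc) => [||/b_c//]; [constructor 2|constructor 3].
have ac : s a <> s c by rewrite -bc.
have a_b : a <> b by move=> e; case: ab; rewrite e.
have a_c : a <> c by move=> e; case: ac; rewrite e.
have sab : s a b = c by apply: swaps_fibre.
have sac : s a c = b by apply: swaps_fibre; auto.
have sba : s b a = a by exact: (singleton_fibre sM ab bc b_c (sM b a)).
pose f x : 'I_3 := if x == a then inord 2 else if x == b then inord 0 else inord 1.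
have fa : f a = inord 2 by rewrite /f eqxx.
have fb : f b = inord 0 by rewrite /f eqxx; case: eqP => // /esym.
have fc : f c = inord 1.
  by rewrite /f; case: eqP => [/esym//|_]; case: eqP => [/esym//|].
have [n20 n21 n01] : [/\ (inord 2 : 'I_3) != inord 0, (inord 2 : 'I_3) != inord 1 &
    (inord 0 : 'I_3) != inord 1] by split; rewrite -val_eqE /= !inordK.
pose g (i : 'I_3) := if i == inord 2 then a else if i == inord 0 then b else c.
exists f; split.
  exists g => [x|i].
    case: (bound x) => ->; rewrite ?fa ?fb ?fc /g ?eqxx //.
      by rewrite eq_sym (negPf n20).
    by rewrite eq_sym (negPf n21) eq_sym (negPf n01).
  rewrite /g; case: eqP => [->//|i2]; case: eqP => [->//|i0].
  rewrite fc; apply: val_inj; move: i2 i0 => /eqP + /eqP; rewrite -!val_eqE /= !inordK //.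
  by case: i => -[|[|[|]]].
move=> x y /=; rewrite rE /= permE /sd_fun /=; congr pair.
have sbc : s b c = c by rewrite bc sxx.
have sca : s c a = a by rewrite -bc sba.
have scb : s c b = b by rewrite -bc sxx.
case: (bound x) => ->; case: (bound y) => ->;
  rewrite ?(sxx, sab, sac, sba, sbc, sca, scb) ?(fa, fb, fc) ?eqxx
    1?[inord 0 == _]eq_sym 1?[inord 1 == inord 2]eq_sym
    ?(negPf n20) ?(negPf n21) ?perm1 ?tpermL ?tpermR //.
by rewrite tpermD // eq_sym.
Qed.

End Counting.
End Quandle.

(** * The classification *)

Theorem theorem5p5 (X : finType) (r : {perm X * X})
  (hnd : non_degenerate r) (hsf : square_free r) (hsd : SD r)
  (hbr : braided r)
  (hX : 1 < #|X|) (horb : #|porbits r| = 2 * #|X| - 1) :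
  [\/ [/\ prime #|X|, odd #|X| & isomorphic r (dihedral #|X|)],
      #|X| = 2 /\ is_trivial r
    | isomorphic r three_point].
Proof.
pose s x : {perm X} := perm (bij_inj (hnd x).1).
have rE x y : r (x, y) = (s x y, x).
  by have := hsd y x; rewrite permE /gamma /sigma; case: (r (x, y)) => u v /= ->.
have sxx x : s x x = x by have := hsf x; rewrite rE => -[].
have sJ x y : s (s x y) = (s y ^ s x)%g.
  apply/permP=> z; rewrite -[z](permKV (s x)) permJ.
  by have := hbr (x, y, (s x)^-1%g z); rewrite /r_12 /r_23 /=; do !rewrite rE /=; case.
have [X2|X2] := eqVneq #|X| 2.
  constructor 2; split=> // x y; rewrite rE; congr pair.
  have [->|xy] := eqVneq x y; first exact: sxx.
  have : s x y \in [set x; y].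
    suff -> : [set x; y] = setT by rewrite inE.
    by apply/eqP; rewrite eqEcard subsetT cardsT X2 cards2 xy.
  rewrite !inE => /orP[/eqP|/eqP//]; rewrite -[RHS]sxx => /perm_inj yx.
  by rewrite yx eqxx in xy.
have X_gt2 : 2 < #|X| by rewrite ltn_neqAle eq_sym X2.
have fibre := fibre_le2 rE sxx sJ horb.
have [a [b ab]] : exists a b, s a <> s b.
  have [a _] : exists a, a \in X by apply/card_gt0P; apply: ltnW.
  have /existsP[b /eqP ab] : [exists b, s a != s b]; last by exists a, b.
  apply: contraT => /existsPn s_const.
  have sE x : s x = s a by apply/esym/eqP/negPn/s_const.
  have /card_gt2P[x [y [z [_ [xy yz zx]]]]] := X_gt2.
  have [||e|e|e] := fibre x y z; rewrite ?sE //.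
  - by rewrite e eqxx in xy.
  - by rewrite e eqxx in zx.
  by rewrite e eqxx in yz.
have [S_gt2|S_le2] := ltnP 2 #|s @: [set: X]|.
  constructor 1; have X_pr := prime_card rE sxx sJ horb S_gt2 ab erefl.
  split=> //; first by apply/negPn/negP => /(prime_oddPn X_pr) E; rewrite E in X2.
  exact: iso_dihedral rE sxx sJ horb S_gt2 _ _ ab _ erefl.
constructor 3.
have two x : s x = s a \/ s x = s b.
  have E : [set s a; s b] = s @: [set: X].
    apply/eqP; rewrite eqEcard subUset !sub1set !imset_f //= cards2.
    by case: eqP ab.
  have : s x \in [set s a; s b] by rewrite E imset_f.
  by rewrite !inE => /orP[]/eqP; auto.
have [c [ca cb]] : exists c, c <> a /\ c <> b.
  have /subsetPn[c _] : ~~ ([set: X] \subset [set a; b]).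
    apply: contraL X_gt2 => /subset_leq_card.
    by rewrite cardsT cards2 -leqNgt => /leq_trans; apply; case: eqP.
  by rewrite !inE => /norP[/eqP ? /eqP ?]; exists c.
case: (two c) => [eq_c|eq_c].
  apply: (iso_three_point rE sxx sJ horb (a := b) (b := a) (c := c)); auto.
  by move=> x; case: (two x); auto.
by apply: (iso_three_point rE sxx sJ horb ab two (c := c)); auto.
Qed.
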